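(* Let $S$, $T$ be nilpotent-free semigroups, and let $g: S \to T$ be an Armendariz map. Then there is a unique Armendariz map $h: T \to E(S)$ such that $h \circ g = e_S$.
   Context: A semigroup with zero is a commutative (multiplicatively written) semigroup $S$ with an absorbing element $0$. It is nilpotent-free if $x^n = 0$ for some positive integer $n$ implies $x=0$. A set map $g: S \to T$ between nilpotent-free semigroups is an Armendariz map if (i) $g$ is surjective; (ii) for any $s\in S$, $s=0$ if and only if $g(s)=0$; (iii) for any $s,s'\in S$, $ss'=0$ if and only if $g(s)g(s')=0$. (It need not be a homomorphism.) For a nilpotent-free semigroup $S$ and $s\in S$, let $\operatorname{ann}(s) = \{a\in S \mid as=0\}$, and define an equivalence relation on $S$ by $s\sim t \iff \operatorname{ann}(s)=\operatorname{ann}(t)$. Then $E(S) = \{[s] \mid s\in S\}$ denotes the set of equivalence classes, which is a nilpotent-free semigroup under the (well-defined) multiplication $[s]\cdot[t] := [st]$, with zero $[0]$; and $e_S: S\to E(S)$ is the map $s\mapsto [s]$. *)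

(* Defs.v *)
From HB Require Import structures.
From mathcomp Require Import all_boot.
From mathcomp Require Import boolp classical_sets.

Set Implicit Arguments.
Unset Strict Implicit.
Unset Printing Implicit Defensive.

Local Open Scope classical_set_scope.
Local Open Scope group_scope.
Local Open Scope quotient_scope.

HB.mixin Record Semigroup_hasZero S of Semigroup S := {
  zerog : S;
  mulgC : commutative (@mul S);
  mul0g : left_zero zerog (@mul S)
}.

#[short(type="semigroup0Type")]
HB.structure Definition Semigroup0 := {S of Semigroup_hasZero S & Semigroup S}.

Notation "0" := (@zerog _) : group_scope.

(* For [0 < n], [iterop n *%g x 0] is the [n]-fold product [x * (x * ...)];
   there is no unit, so [x ^+ n] is not available, and the default [0] is
   only reached at [n = 0]. *)
HB.mixin Record Semigroup0_isNilpotentFree S of Semigroup0 S := {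
  nilpotent_eq0 : forall (x : S) (n : nat),
    (0 < n)%N -> iterop n (@mul S) x 0 = 0 -> x = 0
}.

#[short(type="nilpotentFreeType")]
HB.structure Definition NilpotentFree :=
  {S of Semigroup0_isNilpotentFree S & Semigroup0 S}.

Record Armendariz_map (S T : nilpotentFreeType) (g : S -> T) : Prop := {
  Armendariz_surj : forall t : T, exists s : S, g s = t;
  Armendariz_eq0 : forall s : S, s = 0 <-> g s = 0;
  Armendariz_mul_eq0 : forall s s' : S, s * s' = 0 <-> g s * g s' = 0
}.

Definition ann (S : semigroup0Type) (s : S) : set S := [set a | a * s = 0].

Section AnnQuotient.
Variable S : nilpotentFreeType.
Implicit Types s t : S.

Definition ann_eq s t : bool := `[< ann s = ann t >].

Lemma ann_eqP s t : reflect (ann s = ann t) (ann_eq s t).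
Proof. exact: asboolP. Qed.

Lemma ann_eq_refl : reflexive ann_eq.
Proof. by move=> s; apply/ann_eqP. Qed.

Lemma ann_eq_sym : symmetric ann_eq.
Proof. by move=> s t; apply/ann_eqP/ann_eqP => ->. Qed.

Lemma ann_eq_trans : transitive ann_eq.
Proof. by move=> t s u /ann_eqP st /ann_eqP tu; apply/ann_eqP; rewrite st. Qed.

Canonical ann_equiv := EquivRel ann_eq ann_eq_refl ann_eq_sym ann_eq_trans.

(* The classes [s] are elements of a quotient type rather than subsets of S;
   [e_P] below says that two classes are equal iff the annihilators are. *)
Definition E : Type := {eq_quot ann_equiv}.
HB.instance Definition _ := Choice.on E.
HB.instance Definition _ := EqQuotient.on E.

Definition e_ : S -> E := \pi_E.

Lemma annM s t : ann (s * t) = [set a | ann t (a * s)].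
Proof. by apply/seteqP; split=> a; rewrite /ann /= mulgA. Qed.

Lemma e_P s t : e_ s = e_ t <-> ann s = ann t.
Proof.
rewrite /e_; split=> [/eqmodP/ann_eqP//|st].
by apply/eqmodP/ann_eqP.
Qed.

Definition E_zero : E := e_ 0.
Definition E_mul : E -> E -> E := lift_op2 E *%g.

Lemma E_mulE s t : E_mul (e_ s) (e_ t) = e_ (s * t).
Proof.
have congM (u v w : S) : ann u = ann v -> ann (w * u) = ann (w * v).
  by move=> uv; rewrite !annM uv.
have reprE (u : S) : ann (repr (e_ u)) = ann u by apply/e_P; exact: reprK.
have -> : E_mul (e_ s) (e_ t) = e_ (repr (e_ s) * repr (e_ t)).
  by rewrite /E_mul /= -lock.
apply/e_P.
by rewrite (congM _ _ _ (reprE t)) mulgC (congM _ _ _ (reprE s)) mulgC.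
Qed.

Lemma e_surj (x : E) : exists s, e_ s = x.
Proof. by exists (repr x); exact: reprK. Qed.

Lemma E_mulA : associative E_mul.
Proof.
move=> x y z; have [[s <-] [t <-] [u <-]] := And3 (e_surj x) (e_surj y) (e_surj z).
by rewrite !E_mulE mulgA.
Qed.

Lemma E_mulC : commutative E_mul.
Proof.
by move=> x y; have [s <-] := e_surj x; have [t <-] := e_surj y;
   rewrite !E_mulE mulgC.
Qed.

Lemma E_mul0 : left_zero E_zero E_mul.
Proof. by move=> x; have [s <-] := e_surj x; rewrite E_mulE mul0g. Qed.

HB.instance Definition _ := isSemigroup.Build E E_mulA.
HB.instance Definition _ := Semigroup_hasZero.Build E E_mulC E_mul0.

Lemma e_eq0 s : e_ s = 0 -> s = 0.
Proof.
have -> : 0 = e_ 0 by [].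
move=> /e_P s0; apply: (@nilpotent_eq0 _ s 2) => //=.
have : ann 0 s by rewrite /ann /= mulgC mul0g.
by rewrite -s0.
Qed.

Lemma E_nilpotent_eq0 (x : E) (n : nat) :
  (0 < n)%N -> iterop n *%g x 0 = 0 -> x = 0.
Proof.
have [s <-] := e_surj x; case: n => // n _.
have -> : iterop n.+1 *%g (e_ s) 0 = e_ (iterop n.+1 *%g s 0).
  by elim: n => //= n IHn; rewrite IHn; exact: E_mulE.
by move=> /e_eq0/nilpotent_eq0 ->.
Qed.

HB.instance Definition _ := Semigroup0_isNilpotentFree.Build E E_nilpotent_eq0.

End AnnQuotient.

Arguments e_ : clear implicits.

(* Main.v *)
Require Import Defs.
From mathcomp Require Import all_boot.
From mathcomp Require Import boolp classical_sets.

(** An Armendariz map [g] preserves and reflects vanishing of products, so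
    [ann s] is determined by [g s]: it is the preimage under [g] of [ann (g s)].
    Hence [e_ S] is constant on the fibres of [g] ([Armendariz_ann]), and since
    [g] is surjective, [e_ S] factors through [g] as a map [h] in exactly one
    way.  That [h] is Armendariz comes for free: the projection [e_ S] is itself
    Armendariz ([e_Armendariz]), and each Armendariz condition on [h] can be
    tested on elements [g s], where it compares a condition on [e_ S] with the
    same condition on [g] ([Armendariz_factor]). *)

Local Open Scope group_scope.

Lemma Armendariz_ann (S T : nilpotentFreeType) (g : S -> T) (s s' : S) :
  Armendariz_map g -> g s = g s' -> ann s = ann s'.
Proof.
move=> hg gss'; apply/seteqP; split=> a /(Armendariz_mul_eq0 hg) ga;
  by apply/(Armendariz_mul_eq0 hg); rewrite ?gss' // -gss'.
Qed.

(** Nilpotent-freeness enters here: through [e_eq0], it makes the class of [0]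
    a singleton, and the condition on products follows because the projection
    is multiplicative. *)
Lemma e_Armendariz (S : nilpotentFreeType) : Armendariz_map (e_ S).
Proof.
have e0 (s : S) : s = 0 <-> e_ S s = 0 by split=> [->|/e_eq0].
split=> [|//|s s']; first exact: e_surj.
by rewrite e0 -E_mulE.
Qed.

(** Armendariz maps have the two-out-of-three property in this position:
    surjectivity of [g] reduces every statement about [h] to elements [g s]. *)
Lemma Armendariz_factor (S T U : nilpotentFreeType) (g : S -> T) (h : T -> U) :
  Armendariz_map g -> Armendariz_map (h \o g) -> Armendariz_map h.
Proof.
move=> hg hf; split=> [u|t|t t'].
- by have [s <-] := Armendariz_surj hf u; exists (g s).
- have [s <-] := Armendariz_surj hg t.
  by rewrite -(Armendariz_eq0 hg) (Armendariz_eq0 hf).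
- have [s <-] := Armendariz_surj hg t.
  have [s' <-] := Armendariz_surj hg t'.
  by rewrite -(Armendariz_mul_eq0 hg) (Armendariz_mul_eq0 hf).
Qed.

Theorem theorem3p2 (S T : nilpotentFreeType) (g : S -> T)
    (hg : Armendariz_map g) :
  exists! h : T -> E S, Armendariz_map h /\ h \o g = e_ S.
Proof.
have [r rK] := choice (Armendariz_surj hg).
have hge : (e_ S \o r) \o g = e_ S.
  apply/funext => s; apply/e_P.
  by apply: (Armendariz_ann _ _ _ _ _ hg); rewrite rK.
exists (e_ S \o r); split=> [|h [_ hgE]].
  by split=> //; apply: (Armendariz_factor _ _ _ _ _ hg); rewrite hge;
     exact: e_Armendariz.
by apply/funext => t; rewrite /= -hgE /= rK.
Qed.
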